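(* Let $r\ge 2$ be an integer, $p\in[1,\infty)$, $q\in[1,\infty]$ and $c\in\mathbb{R}$. Let $\{A_i\in\mathcal{B}_r(\Omega_i)\}_{i=1}^\infty$ be a sequence of $r$-th order multi-$P$-operators such that $\sup_i\|A_i\|_{p,\ldots,p\to q}<\infty$, and suppose that it is action convergent to a multi-$P$-operator $A\in\mathcal{B}_r(\Omega)$. Then: (1) if $A_i$ is positivity-preserving for every $i$, then $A$ is also positivity-preserving; (2) if $A_i$ is $c$-regular for every $i$, then $A$ is also $c$-regular.
   Context: An $r$-th order multi-$P$-operator acting on a probability space $(\Omega,\mathcal{F},\mathbb{P})$ is a multi-linear operator $A:L^\infty(\Omega)^{r-1}\to L^1(\Omega)$ (real-valued functions) such that $$\|A\|_{\infty\to 1}:=\sup_{0\neq f^{(i)}\in L^\infty(\Omega)}\frac{\|A[f^{(1)},\ldots,f^{(r-1)}]\|_1}{\|f^{(1)}\|_\infty\cdots\|f^{(r-1)}\|_\infty}<\infty .$$ $\mathcal{B}_r(\Omega)$ is the set of all $r$-th order multi-$P$-operators acting on $\Omega$. For $p,q\in[1,\infty]$, $$\|A\|_{p,\ldots,p\to q}:=\sup_{0\neq f^{(i)}\in L^\infty(\Omega)}\frac{\|A[f^{(1)},\ldots,f^{(r-1)}]\|_q}{\|f^{(1)}\|_p\cdots\|f^{(r-1)}\|_p}.$$ $A\in\mathcal{B}_r(\Omega)$ is positivity-preserving if for all $v_1,\ldots,v_{r-1}\in L^\infty(\Omega)$ that are nonnegative almost everywhere, $A[v_1,\ldots,v_{r-1}]$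 is nonnegative almost everywhere. $A$ is $c$-regular if $A[1_\Omega,\ldots,1_\Omega]=c\,1_\Omega$, where $1_\Omega$ is the constant function $1$. $L^\infty_{[-1,1]}(\Omega)$ denotes the functions in $L^\infty(\Omega)$ with values in $[-1,1]$ almost everywhere, and $\mathcal{L}(\cdot)$ denotes the law of a random vector. For an integer $k\ge1$ the $k$-profile $\mathcal{S}_k(A)\subset\mathcal{P}(\mathbb{R}^{rk})$ is the set of all laws $$\mathcal{L}\big(f_1^{(1)},\ldots,f_1^{(r-1)},A[f_1^{(1)},\ldots,f_1^{(r-1)}],\ldots,f_k^{(1)},\ldots,f_k^{(r-1)},A[f_k^{(1)},\ldots,f_k^{(r-1)}]\big)$$ with all $f^{(j)}_i\in L^\infty_{[-1,1]}(\Omega)$. $d_{\mathcal{LP}}$ is the Lévy–Prokhorov metric on Borel probability measures on Euclidean space (with Euclidean neighbourhoods), and $d_H(X,Y)=\max\{\sup_{x\in X}\inf_{y\in Y}d_{\mathcal{LP}}(x,y),\sup_{y\in Y}\inf_{x\in X}d_{\mathcal{LP}}(x,y)\}$ for sets $X,Y$ of probability measures. The action convergence (pseudo-)metric is $d_M(A,B)=\sum_{k\ge1}2^{-k}d_H(\mathcal{S}_k(A),\mathcal{S}_k(B))$. A sequence $(A_i)$ is action convergent to $A$ if it is Cauchy in $d_M$ and $d_H(\mathcal{S}_k(A_i),\mathcal{S}_k(A))\to0$ for every $k\geq 1$ (equivalently $d_M(A_i,A)\to0$). *)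

(* Defs.v *)
From HB Require Import structures.
From mathcomp Require Import all_boot all_order all_algebra.
From mathcomp Require Import all_classical all_reals all_analysis.
From mathcomp Require Import ess_sup_inf.
Import Order.TTheory GRing.Theory Num.Theory.
Import numFieldNormedType.Exports.

Set Implicit Arguments.
Unset Strict Implicit.
Unset Printing Implicit Defensive.

Local Open Scope classical_set_scope.
Local Open Scope ring_scope.

(* The library's [LfunType] consists of functions, not of classes modulo
   almost-everywhere equality. Hence equalities in $L^\infty$ and $L^1$ are
   written [_ = _ %[ae P]] and operators are required to respect them. *)
Definition Linf {R : realType} {d} {T : measurableType d}
    (P : probability T R) := LfunType P (@leey R 1%E).

Definition L1 {R : realType} {d} {T : measurableType d}
    (P : probability T R) := LfunType P (@lexx _ _ (1%E : \bar R)).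

Definition opnorm {R : realType} {d} {T : measurableType d}
    (P : probability T R) (n : nat) (p q : \bar R)
    (A : ('I_n -> Linf P) -> L1 P) : \bar R :=
  ereal_sup [set ('N[P]_q[EFin \o A f] /
                  \prod_(j < n) 'N[P]_p[EFin \o f j])%E
            | f in [set f : 'I_n -> Linf P |
                     forall j, ~ (f j : T -> R) = cst 0 %[ae P]]].

Record multiPop {R : realType} {d} {T : measurableType d}
    (P : probability T R) (r : nat) := MultiPop {
  mop_fun :> ('I_r.-1 -> Linf P) -> L1 P ;
  mop_ae : forall f g : 'I_r.-1 -> Linf P,
    (forall j, (f j : T -> R) = g j %[ae P]) ->
    (mop_fun f : T -> R) = mop_fun g %[ae P] ;
  mop_linear : forall (f : 'I_r.-1 -> Linf P) (j : 'I_r.-1)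
      (a : R) (u v : Linf P),
    (mop_fun (dfwith f j (a *: u + v)) : T -> R) =
    (fun x => a * mop_fun (dfwith f j u) x + mop_fun (dfwith f j v) x)
    %[ae P] ;
  mop_bounded : (opnorm +oo 1 mop_fun < +oo)%E }.

Definition positivity_preserving {R : realType} {d} {T : measurableType d}
    {P : probability T R} {r : nat} (A : multiPop P r) :=
  forall v : 'I_r.-1 -> Linf P,
    (forall j, {ae P, forall x, 0 <= v j x}) ->
    {ae P, forall x, 0 <= A v x}.

Lemma one_Lfun {R : realType} {d} {T : measurableType d}
    (P : probability T R) : (cst 1 : T -> R) \in Lfun P +oo%E.
Proof.
rewrite inE/=; apply/andP; split; rewrite inE//=.
rewrite /finite_norm unlock /= probability_setT lte01.
apply: (@le_lt_trans _ _ 1%E); last by rewrite ltry.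
by apply/ess_supP/nearW => x /=; rewrite normr1.
Qed.

Definition Linf_one {R : realType} {d} {T : measurableType d}
    (P : probability T R) : Linf P := Lfun_Sub (@leey R 1%E) (one_Lfun P).

Definition regular {R : realType} {d} {T : measurableType d}
    {P : probability T R} {r : nat} (c : R) (A : multiPop P r) :=
  (A (fun=> Linf_one P) : T -> R) = cst c %[ae P].

(* $\mathbb{R}^n$ is [n.-tuple R]; its measurable sets, generated by the
   coordinate projections, are the Borel sets. *)
Definition euclid_dist {R : realType} {n : nat} (x y : n.-tuple R) : R :=
  Num.sqrt (\sum_(i < n) (tnth x i - tnth y i) ^+ 2).

Definition enlarge {R : realType} {n : nat} (e : R) (U : set (n.-tuple R)) :
    set (n.-tuple R) :=
  [set x | exists2 y, U y & euclid_dist x y < e].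

Definition dLP {R : realType} {n : nat}
    (mu nu : probability (n.-tuple (measurableTypeR R)) R) : \bar R :=
  ereal_inf [set e%:E | e in [set e : R | 0 < e /\
    forall U : set (n.-tuple (measurableTypeR R)), measurable U ->
      (mu U <= nu (enlarge e U) + e%:E)%E /\
      (nu U <= mu (enlarge e U) + e%:E)%E]].

Definition dH {R : realType} {n : nat}
    (X Y : set (probability (n.-tuple (measurableTypeR R)) R)) : \bar R :=
  maxe (ereal_sup [set ereal_inf [set dLP x y | y in Y] | x in X])
       (ereal_sup [set ereal_inf [set dLP x y | x in X] | y in Y]).

Section profile.
Context {R : realType} {d} {T : measurableType d} {P : probability T R}
  {r : nat} (A : multiPop P r).

(* The $k \times r$ matrix whose $i$-th row is
   $(f_i^{(1)}, \ldots, f_i^{(r-1)}, A[f_i^{(1)}, \ldots, f_i^{(r-1)}])$ at the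
   point [x]; [insub j] fails exactly at the last column $j = r - 1$. *)
Definition profile_mx {k : nat} (f : 'I_k -> 'I_r.-1 -> Linf P) (x : T) :
    'M[R]_(k, r) :=
  \matrix_(i < k, j < r)
    if insub (val j) is Some j' then f i j' x else A (f i) x.

Definition profile_vec {k : nat} (f : 'I_k -> 'I_r.-1 -> Linf P) (x : T) :
    (k * r)%N.-tuple (measurableTypeR R) :=
  [tuple mxvec (profile_mx f x) 0 l | l < (k * r)%N].

Lemma measurable_profile_vec {k : nat} (f : 'I_k -> 'I_r.-1 -> Linf P) :
  measurable_fun setT (profile_vec f).
Proof.
apply/measurable_fun_tnthP => l.
case/mxvec_indexP: l => i j.
rewrite (_ : _ \o _ = fun x => profile_mx f x i j); last first.
  by apply/funext => x; rewrite /= tnth_mktuple mxvecE.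
rewrite /profile_mx; under eq_fun do rewrite mxE.
case: insub => [j'|]; first exact: (@measurable_funPT _ _ _ _ (f i j')).
exact: (@measurable_funPT _ _ _ _ (A (f i))).
Qed.

HB.instance Definition _ {k : nat} (f : 'I_k -> 'I_r.-1 -> Linf P) :=
  isMeasurableFun.Build _ _ T _ (profile_vec f) (measurable_profile_vec f).

Definition profile (k : nat) :
    set (probability ((k * r)%N.-tuple (measurableTypeR R)) R) :=
  [set (distribution P (profile_vec f) : probability _ R)
  | f in [set f : 'I_k -> 'I_r.-1 -> Linf P |
           forall i j, {ae P, forall x, -1 <= f i j x <= 1}]].

End profile.
Arguments profile {R d T P r} A k _.

Definition dM {R : realType} {r : nat}
    {d1} {T1 : measurableType d1} {P1 : probability T1 R}
    {d2} {T2 : measurableType d2} {P2 : probability T2 R}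
    (A : multiPop P1 r) (B : multiPop P2 r) : \bar R :=
  (\sum_(1 <= k <oo) (2 ^- k)%:E * dH (profile A k) (profile B k))%E.

Definition action_convergent {R : realType} {r : nat}
    {d_ : nat -> measure_display} {T_ : forall i, measurableType (d_ i)}
    {P_ : forall i, probability (T_ i) R} (A_ : forall i, multiPop (P_ i) r)
    {d} {T : measurableType d} {P : probability T R} (A : multiPop P r) :=
  (forall e : R, 0 < e -> exists N : nat, forall m n : nat,
     (N <= m)%N -> (N <= n)%N -> (dM (A_ m) (A_ n) < e%:E)%E) /\
  (forall k : nat, (1 <= k)%N ->
     dH (profile (A_ i) k) (profile A k) @[i --> \oo] --> 0%E).

(* Main.v *)
(* Let v take its values in [a, 1]; a = 0 is used for positivity, a = 1 for
   regularity. Convergence of the 1-profiles gives, for some i, inputs f in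
   [-1, 1] such that the law of (f, A_i f) is Levy-Prokhorov close to that of
   (v, A v). Hence f_j < a - e only with small probability, so that
   g_j = max(f_j, a) is close to f_j in L^p because both are bounded. Replacing
   the inputs one at a time, the uniform bound on the norms makes A_i f - A_i g
   small in L^1, hence in probability. If A_i g always lies in a closed set F,
   then A v is within any given positive distance of F with probability
   arbitrarily close to 1, so A v lies in F almost surely. Take F = [0, +oo) for
   positivity and F = {c} for regularity: for a = 1, g is the constant 1. *)
Require Import Defs.
From mathcomp Require Import all_boot all_order all_algebra.
From mathcomp Require Import all_classical all_reals all_analysis.
From mathcomp Require Import ess_sup_inf measurable_realfun ring lra.
Import Order.TTheory GRing.Theory Num.Theory.
Import numFieldNormedType.Exports.

Set Implicit Arguments.
Unset Strict Implicit.
Unset Printing Implicit Defensive.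

Local Open Scope classical_set_scope.
Local Open Scope ring_scope.

(** * Norm inequalities on a probability space *)

Section Lnorm_probability.
Context {R : realType} {d} {T : measurableType d} (P : probability T R).
Implicit Types (f : T -> R) (p e M : R) (q : \bar R).

(** For finite [q] this is Hölder against the constant 1; for [q = +oo] the integrand is almost
    everywhere at most its essential supremum. *)
Lemma Lnorm1_le f q : measurable_fun setT f -> (1 <= q)%E ->
  ('N[P]_1[EFin \o f] <= 'N[P]_q[EFin \o f])%E.
Proof.
move=> mf; case: q => [q| |//].
- rewrite lee_fin le_eqVlt => /predU1P[<-//|q1].
  have q0 : 0 < q by rewrite (lt_trans _ q1).
  pose q' := q / (q - 1).
  have q'0 : 0 < q' by rewrite divr_gt0// subr_gt0.
  have qq' : q^-1 + q'^-1 = 1.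
    by rewrite /q' invf_div; field; rewrite !gt_eqF ?subr_gt0.
  have := @hoelder _ _ _ P f (cst 1) q q' mf (measurable_cst _) q0 q'0 qq'.
  rewrite (_ : f \* cst 1 = f); last by apply/funext => x /=; rewrite mulr1.
  rewrite (_ : EFin \o cst 1 = cst 1%E)// Lnorm_cst1.
  by rewrite [X in (X `^ _)%E](@probability_setT _ _ _ P) poweR1r mule1.
- move=> _; rewrite Lnorm1 [in leRHS]Lnorm.unlock /=.
  rewrite probability_setT lte01.
  set S := ess_sup P _.
  have S0 : (0 <= S)%E.
    apply: ess_sup_gee; last by apply: aeW => x /=.
    by rewrite [X in (_ < X)%E](@probability_setT _ _ _ P).
  apply: (@le_trans _ _ (\int[P]_x (cst S x))%E).
    apply: ae_ge0_le_integral => //.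
    + exact/measurable_EFinP/measurableT_comp.
    + by move: (ess_sup_ge P (abse \o (EFin \o f))); apply: filterS.
  by rewrite integral_cst// [X in (_ * X)%E](@probability_setT _ _ _ P) mule1.
Qed.

Lemma markov_Lnorm f q e : measurable_fun setT f -> (1 <= q)%E -> 0 < e ->
  (e%:E * P [set x | (e <= `|f x|)%R] <= 'N[P]_q[EFin \o f])%E.
Proof.
move=> mf q1 e0; apply: le_trans (Lnorm1_le mf q1).
rewrite Lnorm1 -(setTI [set x | _]).
by apply: (@le_integral_comp_abse _ _ _ P _ measurableT (EFin \o f) e id)
  => //; exact/measurable_EFinP.
Qed.

(** The integrand is at most [e ^ p] where [|f| <= e] and at most [M ^ p] elsewhere. Smallness in
    probability of a bounded function thus becomes smallness in $L^p$, which is where the finiteness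
    of $p$ enters. *)
Lemma Lnorm_le_prob f p e M : measurable_fun setT f -> 1 <= p ->
  0 <= e -> 0 <= M -> {ae P, forall x, `|f x| <= M} ->
  ('N[P]_p%:E[EFin \o f] <=
   ((e `^ p)%:E + (M `^ p)%:E * P [set x | (e < `|f x|)%R]) `^ p^-1)%E.
Proof.
move=> mf p1 e0 M0 fM; rewrite unlock /=.
have p0 : 0 <= p by rewrite (le_trans _ p1).
set D := [set x | _].
have mD : measurable D.
  rewrite -[D]setTI; apply: measurable_fun_ltr => //.
  exact: measurableT_comp.
apply: gt0_ler_poweR; rewrite ?invr_ge0//.
- rewrite in_itv/= leey andbT; apply: integral_ge0 => x _.
  by rewrite lee_fin powR_ge0.
- rewrite in_itv/= leey andbT adde_ge0//.
    by rewrite lee_fin powR_ge0.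
  by rewrite mule_ge0// lee_fin powR_ge0.
rewrite [leRHS](_ : _ =
    \int[P]_x ((e `^ p)%:E + (M `^ p * \1_D x)%:E))%E; last first.
  rewrite ge0_integralD//=.
  - congr (_ + _)%E.
      rewrite -[LHS]mule1 -[X in (_ * X)%E](@probability_setT _ _ _ P).
      by rewrite -(@integral_cst _ _ _ P setT measurableT).
    rewrite (@integralZl_indic _ _ _ P _ measurableT (fun=> D))//.
      by rewrite integral_indic// setIT.
    by rewrite ltNge powR_ge0.
  - by move=> x _; rewrite lee_fin powR_ge0.
  - by move=> x _; rewrite lee_fin mulr_ge0// powR_ge0.
  - exact/measurable_EFinP/measurable_funM.
apply: ae_ge0_le_integral => //.
- apply/measurable_EFinP/(measurableT_comp (measurable_powR _)) => //.
  exact: measurableT_comp.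
- by move=> x _; rewrite -EFinD lee_fin addr_ge0 ?mulr_ge0 ?powR_ge0.
- apply/measurable_EFinP; apply: measurable_funD => //.
  exact: measurable_funM.
- apply: filterS fM => x fxM _.
  rewrite lee_fin indicE; case: (boolP (x \in D)) => [_|].
    rewrite mulr1 -[leLHS]add0r lerD// ?powR_ge0//.
    exact: ge0_ler_powR.
  rewrite notin_setE /D /= => /negP; rewrite -leNgt => fe.
  by rewrite mulr0 addr0 ge0_ler_powR.
Qed.

Lemma Lnorm_le1 f p : measurable_fun setT f -> 1 <= p ->
  (* The previous bound is used with [e = M = 1], for which the exceptional set is null. *)
  {ae P, forall x, `|f x| <= 1} -> ('N[P]_p%:E[EFin \o f] <= 1)%E.
Proof.
move=> mf p1 f1; have := Lnorm_le_prob mf p1 ler01 ler01 f1.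
rewrite (_ : P [set x | _] = 0%E).
  by rewrite mule0 adde0 powR1 poweR1r.
have mD : measurable [set x | 1 < `|f x|].
  rewrite -[X in _ X]setTI; apply: measurable_fun_ltr => //.
  exact: measurableT_comp.
apply: (measure_negligible mD); move: f1; apply: negligibleS => x /= fx.
by rewrite leNgt fx.
Qed.

Lemma Lfun_oo_bounded f M : measurable_fun setT f ->
  {ae P, forall x, `|f x| <= M} -> f \in Lfun P +oo%E.
Proof.
move=> mf fM; rewrite inE/=; apply/andP; split; rewrite inE//=.
rewrite /finite_norm unlock /= probability_setT lte01.
by apply: (@le_lt_trans _ _ M%:E); [apply/ess_supP|rewrite ltry].
Qed.

End Lnorm_probability.

(** * Multilinearity and continuity in the $p$-norms *)

Section multilinear.
Context {R : realType} {d} {T : measurableType d} {P : probability T R}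
  {r : nat} (A : multiPop P r).
Implicit Types f g h : 'I_r.-1 -> Linf P.

Lemma ae_eq_Lnorm1 (u v : T -> R) : measurable_fun setT u ->
  measurable_fun setT v -> u = v %[ae P] ->
  ('N[P]_1[EFin \o u] = 'N[P]_1[EFin \o v])%E.
Proof.
move=> mu mv uv; rewrite !Lnorm1; apply: ge0_ae_eq_integral => //.
- exact/measurable_EFinP/measurableT_comp.
- exact/measurable_EFinP/measurableT_comp.
- by apply: filterS uv => x /= /[apply] ->.
Qed.

(** The null argument is replaced by [-1 *: 0 + 0], and linearity then gives a value of the form $-y
    + y$. *)
Lemma mop_zero f j : (f j : T -> R) = cst 0 %[ae P] ->
  (A f : T -> R) = cst 0 %[ae P].
Proof.
move=> fj0.
have : (A f : T -> R) = A (dfwith f j (-1 *: 0 + 0)) %[ae P].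
  apply: mop_ae => k; case: dfwithP => [|i _]; last by apply: aeW.
  by rewrite scaler0 addr0; apply: filterS fj0 => x /= /[apply] ->.
have := mop_linear A f j (-1) 0 0.
by apply: filterS2 => x /= e1 e2 _; rewrite e2// e1// mulN1r addNr.
Qed.

(** Consecutive hybrids differ in a single argument, so induction on [m] passes from [f] to [g] with
    one use of [mop_linear] per step. *)
Definition hybrid f g (m : nat) : 'I_r.-1 -> Linf P :=
  fun j => if (j < m)%N then g j else f j.

Lemma hybrid0 f g : hybrid f g 0 = f.
Proof. by apply/funext => j. Qed.

Lemma hybrid_full f g : hybrid f g r.-1 = g.
Proof. by apply/funext => j; rewrite /hybrid ltn_ord. Qed.

(** This trivial update and [hybridS] present hybrids [m] and [m.+1] as updates of one tuple at the
    same place, the form required by [mop_linear]. *)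
Lemma hybridE f g (m : 'I_r.-1) : hybrid f g m = dfwith (hybrid f g m) m (f m).
Proof.
by apply/funext => j; case: dfwithP => //; rewrite /hybrid ltnn.
Qed.

Lemma hybridS f g (m : 'I_r.-1) :
  hybrid f g m.+1 = dfwith (hybrid f g m) m (g m).
Proof.
apply/funext => j; case: dfwithP => [|i mi]; first by rewrite /hybrid ltnSn.
rewrite /hybrid ltnS leq_eqVlt (_ : _ == _ = false)//.
by apply/eqP => /val_inj/esym/eqP; apply/negP.
Qed.

Lemma mop_scale f (a : R) :
  (A (fun j => a *: f j) : T -> R) = (fun x => a ^+ r.-1 * A f x) %[ae P].
Proof.
suff H m : (m <= r.-1)%N -> (A (hybrid f (fun j => a *: f j) m) : T -> R) =
    (fun x => a ^+ m * A f x) %[ae P].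
  by rewrite -[X in A X](hybrid_full f); exact: H.
elim: m => [_|m IH mr].
  by rewrite hybrid0; apply: aeW => x _; rewrite mul1r.
have {IH} := IH (ltnW mr).
(* Linearity is used with second summand 0; the extra term it produces vanishes by [mop_zero]. *)
have := mop_linear A (hybrid f (fun j => a *: f j) m) (Ordinal mr) a
  (f (Ordinal mr)) 0.
have := @mop_zero (dfwith (hybrid f (fun j => a *: f j) m) (Ordinal mr) 0)
  (Ordinal mr).
rewrite dfwithin => /(_ (aeW _ _)) Z.
have {}Z := Z (fun _ _ => erefl).
move: Z; apply: filterS3 => x /= e0 e1 e2 _.
rewrite -[m.+1]/((Ordinal mr).+1) hybridS.
move: e1 e2; rewrite addr0 -(hybridE f _ (Ordinal mr)) => -> // -> //.
by rewrite e0// addr0 exprS mulrA.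
Qed.

(** The supremum in [opnorm] only ranges over tuples without null arguments. With a null argument
    the value is null by [mop_zero]; otherwise the denominator is a positive real and can be
    cleared. *)
Lemma opnorm_le_Lnorm1 f (p q : \bar R) (K : R) (D : 'I_r.-1 -> R) :
  (1 <= p)%E -> (1 <= q)%E -> 0 <= K ->
  (opnorm p q A <= K%:E)%E ->
  (forall j, 'N[P]_p[EFin \o f j] <= (D j)%:E)%E ->
  ('N[P]_1[EFin \o A f] <= (K * \prod_j D j)%:E)%E.
Proof.
move=> p1 q1 K0 AK fD.
have mA h : measurable_fun setT (A h : T -> R).
  exact: (@measurable_funPT _ _ _ _ (A h)).
have D0 j : 0 <= D j.
  by rewrite -lee_fin (le_trans _ (fD j))// Lnorm_ge0.
have [[j fj0]|f0] := pselect (exists j, (f j : T -> R) = cst 0 %[ae P]).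
  rewrite (ae_eq_Lnorm1 _ _ (mop_zero fj0))//.
  rewrite (_ : EFin \o cst 0 = cst 0%E)// Lnorm0//.
  by rewrite lee_fin mulr_ge0// prodr_ge0.
apply: (le_trans (Lnorm1_le P (mA f) q1)).
have Nf j : exists2 c : R, 0 < c <= D j & ('N[P]_p[EFin \o f j] = c%:E)%E.
  have mf : measurable_fun setT (EFin \o f j).
    exact/measurable_EFinP/(@measurable_funPT _ _ _ _ (f j)).
  have : ('N[P]_p[EFin \o f j] != 0)%E.
    apply/eqP => N0; apply: f0; exists j.
    move: (Lnorm_eq0_eq0 mf (lt_le_trans lte01 p1) N0).
    by apply: filterS => x /= /[apply] -[].
  move: (fD j) (Lnorm_ge0 P p (EFin \o f j)).
  case: ('N[P]_p[EFin \o f j])%E => [c| |]//.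
  rewrite !lee_fin eqe => cD c0 cn; exists c => //.
  by rewrite lt_neqAle eq_sym cn c0.
have /choice[c /all_and2[cD Nc]] : forall j, exists c : R,
    0 < c <= D j /\ ('N[P]_p[EFin \o f j] = c%:E)%E.
  by move=> j; have [c ? ?] := Nf j; exists c.
have : ('N[P]_q[EFin \o A f] / (\prod_(j < r.-1) c j)%:E <= K%:E)%E.
  apply: le_trans AK; apply: ereal_sup_ubound; exists f.
    by move=> j fj0; apply: f0; exists j.
  by rewrite -prodEFin; under eq_bigr do rewrite Nc.
have c0 : 0 < \prod_(j < r.-1) c j.
  by apply: prodr_gt0 => j _; have /andP[] := cD j.
rewrite inver gt_eqF// lee_pdivrMr// => /le_trans; apply.
rewrite -EFinM lee_fin ler_wpM2l// ler_prod// => j _.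
by have /andP[/ltW -> ->] := cD j.
Qed.

(** The difference telescopes along the hybrids. Each of the [r.-1] increments is a value of [A]
    with one argument [f j - g j], of norm at most [t], and all others of norm at most 1. *)
Lemma mop_sub_Lnorm1 f g (p q : \bar R) (K t : R) :
  (1 <= p)%E -> (1 <= q)%E -> 0 <= K -> 0 <= t -> (opnorm p q A <= K%:E)%E ->
  (forall j, 'N[P]_p[EFin \o f j] <= 1)%E ->
  (forall j, 'N[P]_p[EFin \o g j] <= 1)%E ->
  (forall j, 'N[P]_p[EFin \o (f j \- g j)%R] <= t%:E)%E ->
  ('N[P]_1[EFin \o (A f \- A g)%R] <= (r.-1%:R * (K * t))%:E)%E.
Proof.
move=> p1 q1 K0 t0 AK f1 g1 fg.
have mA h : measurable_fun setT (A h : T -> R).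
  exact: (@measurable_funPT _ _ _ _ (A h)).
suff H m : (m <= r.-1)%N ->
    ('N[P]_1[EFin \o (A f \- A (hybrid f g m))%R] <= (m%:R * (K * t))%:E)%E.
  by have := H _ (leqnn _); rewrite hybrid_full.
elim: m => [_|m IH mr].
  rewrite hybrid0 mul0r (_ : _ \o _ = cst 0%E) ?Lnorm0//.
  by apply/funext => x /=; rewrite subrr.
pose j := Ordinal mr; pose h := hybrid f g m.
have mh : measurable_fun setT (A h \- A (hybrid f g m.+1)).
  exact: measurable_funB.
have step : ('N[P]_1[EFin \o (A h \- A (hybrid f g m.+1))%R] <= (K * t)%:E)%E.
  have E : (A h \- A (hybrid f g m.+1) : T -> R) =
      A (dfwith h j (-1 *: g j + f j)) %[ae P].
    have := mop_linear A h j (-1) (g j) (f j).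
    rewrite -(hybridE f _ j) -(hybridS f _ j);
    apply: filterS => x /= /[apply] ->.
    by rewrite mulN1r addrC.
  rewrite (ae_eq_Lnorm1 _ _ E)//.
  (* The product of the norm bounds has factor [t] at the updated place and 1 elsewhere. *)
  have -> : t = \prod_(i < r.-1) (if i == j then t else 1).
    by rewrite -big_mkcond big_pred1_eq.
  apply: (opnorm_le_Lnorm1 p1 q1 K0 AK) => i.
  case: eqP => [->|/eqP ij].
    rewrite dfwithin; have := fg j.
    rewrite (_ : _ \- _ = (-1 *: g j + f j : Linf P) :> (T -> R))//.
    by apply/funext => x /=; rewrite addrC -scaleN1r.
  by rewrite dfwithout 1?eq_sym// /h /hybrid; case: ifP.
rewrite (_ : A f \- _ = (A f \- A h) \+ (A h \- A (hybrid f g m.+1))).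
  rewrite -(natr1 m) mulrDl mul1r EFinD.
  apply: (le_trans _ (leeD (IH (ltnW mr)) step)).
  by apply: eminkowski => //; exact: measurable_funB.
by apply/funext => x /=; rewrite addrA subrK.
Qed.
End multilinear.

(** * Lévy-Prokhorov distance and one-coordinate marginals *)

Section levy_prokhorov.
Context {R : realType} {n : nat}.
Implicit Types mu nu : probability (n.-tuple (measurableTypeR R)) R.

(** Euclidean distance dominates each coordinate difference; conversely, altering only coordinate
    [l] moves a point by exactly the change in that coordinate. *)
Lemma enlarge_coord (l : 'I_n) (e : R) (B : set R) :
  enlarge e [set x : n.-tuple R | B (tnth x l)] =
  [set x | exists2 t, B t & `|tnth x l - t| < e].
Proof.
apply/seteqP; split => x /= [].
  move=> y By xye; exists (tnth y l) => //; apply: le_lt_trans xye.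
  rewrite -sqrtr_sqr /euclid_dist ler_wsqrtr// (bigD1 l)//= lerDl.
  by apply: sumr_ge0 => i _; exact: sqr_ge0.
move=> t Bt xte; exists [tuple if i == l then t else tnth x i | i < n].
  by rewrite /= tnth_mktuple eqxx.
rewrite /euclid_dist (bigD1 l)//= big1 ?addr0.
  by rewrite tnth_mktuple eqxx sqrtr_sqr.
by move=> i il; rewrite tnth_mktuple (negbTE il) subrr expr0n.
Qed.

Lemma dLP_sym mu nu : dLP mu nu = dLP nu mu.
Proof.
rewrite /dLP; congr ereal_inf; apply/seteqP.
by split=> _ [e [e0 H] <-]; exists e => //; split=> // U mU;
  have [? ?] := H U mU.
Qed.

Lemma measurable_coord (l : 'I_n) (B : set R) : measurable B ->
  measurable [set x : n.-tuple (measurableTypeR R) | B (tnth x l)].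
Proof.
move=> mB; rewrite -[X in measurable X]setTI.
exact: (measurable_tnth l).
Qed.

(** The distance is tested on the cylinder over [B]; by [enlarge_coord] its enlargement is again a
    cylinder, contained in the one over [B']. *)
Lemma dLP_coord mu nu (e : R) (l : 'I_n) (B B' : set R) :
  measurable B -> measurable B' ->
  (forall s t, B t -> `|s - t| < e -> B' s) ->
  (dLP mu nu < e%:E)%E ->
  (mu [set x | B (tnth x l)] <= nu [set x | B' (tnth x l)] + e%:E)%E.
Proof.
move=> mB mB' BB' /ereal_inf_lt[_ [e' [e'0 H] <-]]; rewrite lte_fin => e'e.
have [+ _] := H _ (measurable_coord l mB).
rewrite enlarge_coord => /le_trans; apply.
rewrite leeD ?lee_fin ?(ltW e'e)// le_measure ?inE//.
(* The base of the enlarged cylinder is a union of open balls, hence measurable. *)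
- have -> : [set x : n.-tuple R | exists2 t, B t & `|tnth x l - t| < e'] =
      [set x | (\bigcup_(t in B) ball t e') (tnth x l)].
    apply/seteqP; split => x [t Bt]; rewrite /= /ball /= 1?distrC => ?;
      by exists t; rewrite //= /ball/= 1?distrC.
  apply: measurable_coord; apply: open_measurable.
  by apply: bigcup_open => t _; exact: ball_open.
- exact: measurable_coord.
- by move=> x [t Bt xt]; apply: BB' Bt (lt_trans xt _).
Qed.

End levy_prokhorov.

Lemma dH_approx {R : realType} {n : nat}
    (X Y : set (probability (n.-tuple (measurableTypeR R)) R)) (e : R) y :
  (dH X Y < e%:E)%E -> Y y -> exists2 x, X x & (dLP x y < e%:E)%E.
Proof.
rewrite /dH gt_max => /andP[_ XY] Yy.
suff /ereal_inf_lt[_ [x Xx <-] ?] :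
  (ereal_inf [set dLP x y | x in X] < e%:E)%E by exists x.
by apply: le_lt_trans XY; apply: ereal_sup_ubound; exists y.
Qed.

(** * Reading inputs and output off a 1-profile *)

Section profile_coordinates.
Context {R : realType} {d} {T : measurableType d} {P : probability T R}
  {r : nat} (A : multiPop P r) (r2 : (2 <= r)%N).

Definition input_index (j : 'I_r.-1) : 'I_(1 * r) :=
  mxvec_index ord0 (Ordinal (leq_trans (ltn_ord j) (leq_pred r))).

Definition output_index : 'I_(1 * r) :=
  mxvec_index ord0 (Ordinal (etrans (ltn_predL r) (ltnW r2))).

Lemma profile_vec_input (f : 'I_1 -> 'I_r.-1 -> Linf P) j x :
  tnth (profile_vec A f x) (input_index j) = f ord0 j x.
Proof.
rewrite tnth_mktuple mxvecE mxE /= insubT//= => H.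
by congr (f _ _ _); apply: val_inj.
Qed.

Lemma profile_vec_output (f : 'I_1 -> 'I_r.-1 -> Linf P) x :
  tnth (profile_vec A f x) output_index = A (f ord0) x.
Proof. by rewrite tnth_mktuple mxvecE mxE /= insubF// ltnn. Qed.

Lemma distribution_input (f : 'I_1 -> 'I_r.-1 -> Linf P) j (B : set R) :
  distribution P (profile_vec A f) [set x | B (tnth x (input_index j))] =
  P [set x | B (f ord0 j x)].
Proof.
rewrite [LHS]/(P _); congr (P _); apply/funext => x.
by rewrite /preimage /mkset profile_vec_input.
Qed.

Lemma distribution_output (f : 'I_1 -> 'I_r.-1 -> Linf P) (B : set R) :
  distribution P (profile_vec A f) [set x | B (tnth x output_index)] =
  P [set x | B (A (f ord0) x)].
Proof.
rewrite [LHS]/(P _); congr (P _); apply/funext => x.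
by rewrite /preimage /mkset profile_vec_output.
Qed.

End profile_coordinates.

(** A single [f] serves all test sets and coordinates. The two inequalities run in opposite
    directions: the inputs [f] inherit constraints from [v], while [A2 v] inherits them from
    [A1 f]. *)
Lemma dH_profile_transfer {R : realType} {r : nat}
    {d1} {T1 : measurableType d1} {P1 : probability T1 R}
    {d2} {T2 : measurableType d2} {P2 : probability T2 R}
    (A1 : multiPop P1 r) (A2 : multiPop P2 r) (e : R)
    (v : 'I_r.-1 -> Linf P2) :
  (2 <= r)%N -> (dH (profile A1 1) (profile A2 1) < e%:E)%E ->
  (forall j, {ae P2, forall x, -1 <= v j x <= 1}) ->
  exists2 f : 'I_r.-1 -> Linf P1,
    forall j, {ae P1, forall x, -1 <= f j x <= 1} &
    forall B B' : set R, measurable B -> measurable B' ->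
      (forall s t, B t -> `|s - t| < e -> B' s) ->
      (forall j, (P1 [set x | B (f j x)] <=
                  P2 [set x | B' (v j x)] + e%:E)%E) /\
      (P2 [set x | B (A2 v x)] <= P1 [set x | B' (A1 f x)] + e%:E)%E.
Proof.
move=> r2 dHe v1.
have [|_ [f f1 <-] fv] := dH_approx dHe
    (y := distribution P2 (profile_vec A2 (fun _ : 'I_1 => v))).
  by exists (fun=> v).
exists (f ord0) => // B B' mB mB' BB'; split=> [j|].
  rewrite -(distribution_input A1 f j B).
  rewrite -[P2 _](distribution_input A2 (fun=> v) j B').
  exact: dLP_coord fv.
rewrite -[P2 _](distribution_output A2 r2 (fun=> v) B).
rewrite -(distribution_output A1 r2 f B').
by apply: dLP_coord => //; rewrite dLP_sym.
Qed.

(** * Truncation of the inputs from below *)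

Lemma powR_modulus {R : realType} (p t : R) : 1 <= p -> 0 < t ->
  exists2 e0 : R, 0 < e0 & forall e, 0 < e -> e <= e0 ->
    (e `^ p + 2 `^ p * e) `^ p^-1 <= t.
Proof.
move=> p1 t0; have p0 : 0 < p by rewrite (lt_le_trans _ p1).
have C0 : 0 < 1 + 2 `^ p :> R by rewrite addr_gt0// powR_gt0.
(* For [e <= 1] one has [e ^ p <= e], so the sum is at most [(1 + 2 ^ p) * e], which the second
   bound keeps below [t ^ p]. *)
exists (Num.min 1 (t `^ p / (1 + 2 `^ p))).
  by rewrite lt_min ltr01 divr_gt0// powR_gt0.
move=> e e0; rewrite le_min => /andP[e1]; rewrite ler_pdivlMr// => et.
rewrite -[leRHS](powRr1 (ltW t0)).
rewrite -[X in _ <= _ `^ X](@mulfV _ p) ?gt_eqF// powRrM.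
apply: ge0_ler_powR; rewrite ?invr_ge0 ?(ltW p0)// ?nnegrE ?powR_ge0//.
  by rewrite addr_ge0 ?powR_ge0// mulr_ge0 ?powR_ge0// ltW.
rewrite mulrDr mulr1 [e * _]mulrC in et.
apply: (le_trans _ et); rewrite lerD2r.
by apply: ge1r_powR => //; rewrite e0.
Qed.

Section truncation.
Context {R : realType} {d} {T : measurableType d} {P : probability T R}
  {r : nat} (A : multiPop P r).

Lemma truncation_close (f : 'I_r.-1 -> Linf P) (p : R) (q : \bar R)
    (K a e t : R) :
  1 <= p -> (1 <= q)%E -> 0 <= K -> -1 <= a <= 1 -> 0 <= e ->
  (e `^ p + 2 `^ p * e) `^ p^-1 <= t ->
  (opnorm p%:E q A <= K%:E)%E ->
  (forall j, {ae P, forall x, -1 <= f j x <= 1}) ->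
  (forall j, P [set x | (f j x < a - e)%R] <= e%:E)%E ->
  exists2 g : 'I_r.-1 -> Linf P,
    forall j, {ae P, forall x, a <= g j x <= 1} &
    forall s, 0 < s ->
      (s%:E * P [set x | (s <= `|A f x - A g x|)%R] <=
       (r.-1%:R * (K * t))%:E)%E.
Proof.
move=> p1 q1 K0 /andP[a1 a2] e0 et AK f1 fa.
have mf j : measurable_fun setT (f j : T -> R).
  exact: (@measurable_funPT _ _ _ _ (f j)).
have mA h : measurable_fun setT (A h : T -> R).
  exact: (@measurable_funPT _ _ _ _ (A h)).
have mg j : measurable_fun setT (fun x => Num.max (f j x) a).
  by apply: measurable_maxr => //; exact: mf.
have gb j : {ae P, forall x, a <= Num.max (f j x) a <= 1}.
  apply: filterS (f1 j) => x /andP[_ fx].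
  by rewrite le_max lexx orbT ge_max fx.
have gL j : (fun x => Num.max (f j x) a) \in Lfun P +oo%E.
  apply: (@Lfun_oo_bounded _ _ _ P _ 1) => //.
  apply: filterS (gb j) => x /andP[gx ?].
  by rewrite ler_norml (le_trans a1 gx).
pose g j : Linf P := Lfun_Sub (@leey R 1%E) (gL j).
exists g => // s s0.
have mAB : measurable_fun setT (A f \- A g) by exact: measurable_funB.
apply: (le_trans (markov_Lnorm P mAB (lexx _) s0)).
have t0 : 0 <= t by apply: le_trans et; exact: powR_ge0.
apply: (mop_sub_Lnorm1 _ q1 K0 t0 AK) => // j.
- apply: Lnorm_le1 => //; apply: filterS (f1 j) => x.
  by rewrite ler_norml.
- apply: Lnorm_le1 => //; apply: filterS (gb j) => x /andP[gx ?].
  by rewrite ler_norml (le_trans a1 gx).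
have mfg : measurable_fun setT (f j \- g j) by exact: measurable_funB.
(* Both functions take values in $[-1,1]$; this is the source of the constant [2 ^ p]. *)
have fg2 : {ae P, forall x, `|(f j \- g j) x| <= 2}.
  apply: filterS2 (f1 j) (gb j) => x /= /andP[? ?] /andP[? ?].
  by rewrite ler_norml; apply/andP; split; lra.
apply: (le_trans (Lnorm_le_prob mfg p1 e0 (ler0n _ 2) fg2)).
apply: (@le_trans _ _ ((e `^ p + 2 `^ p * e)%:E `^ p^-1)%E); last first.
  by rewrite poweR_EFin lee_fin.
apply: gt0_ler_poweR.
- by rewrite invr_ge0 (le_trans _ p1).
- by rewrite in_itv/= leey andbT adde_ge0 ?mule_ge0// lee_fin powR_ge0.
- by rewrite in_itv/= leey andbT lee_fin addr_ge0 ?mulr_ge0 ?powR_ge0.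
rewrite EFinD leeD2l// EFinM lee_wpmul2l ?lee_fin ?powR_ge0//.
apply: le_trans (fa j); apply: le_measure; rewrite ?inE.
- rewrite -[X in _ X]setTI; apply: measurable_fun_ltr => //.
  exact: measurableT_comp.
- by rewrite -[X in _ X]setTI; exact: measurable_fun_ltr.
(* Truncation alters [f j] only below [a], by [a - f j x]; a change larger than [e] forces
   [f j x < a - e]. *)
move=> x /=; case: (leP (f j x) a) => fxa; last first.
  by rewrite subrr normr0 ltNge e0.
by rewrite ler0_norm ?subr_le0//; lra.
Qed.

End truncation.

(** * Passage to the limit *)

Lemma action_limit_closed (R : realType) (r : nat) (p : R) (q : \bar R)
    (d_ : nat -> measure_display) (T_ : forall i, measurableType (d_ i))
    (P_ : forall i, probability (T_ i) R)
    (A_ : forall i, multiPop (P_ i) r)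
    (d : measure_display) (T : measurableType d) (P : probability T R)
    (A : multiPop P r) (a : R) (F : set R) (v : 'I_r.-1 -> Linf P) :
  (2 <= r)%N -> 1 <= p -> (1 <= q)%E ->
  (ereal_sup [set opnorm p%:E q (A_ i) | i in [set: nat]] < +oo)%E ->
  action_convergent A_ A ->
  -1 <= a <= 1 -> closed F ->
  (forall i (g : 'I_r.-1 -> Linf (P_ i)),
    (forall j, {ae P_ i, forall x, a <= g j x <= 1}) ->
    {ae P_ i, forall x, F (A_ i g x)}) ->
  (forall j, {ae P, forall x, a <= v j x <= 1}) ->
  {ae P, forall x, F (A v x)}.
Proof.
move=> r2 p1 q1 supA [_ /(_ 1%N isT) cvA] a11 cF FA va.
have [K K0 AK] : exists2 K : R, 0 <= K &
    forall i, (opnorm p%:E q (A_ i) <= K%:E)%E.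
  move: supA; set S := ereal_sup _ => Soo.
  exists (Num.max 0 (fine S)); first by rewrite le_max lexx.
  move=> i; apply: (@le_trans _ _ S).
    by apply: ereal_sup_ubound; exists i.
  case: S Soo => [s| |]// _; last by rewrite leNye.
  by rewrite lee_fin le_max lexx orbT.
have mAv : measurable_fun setT (A v : T -> R).
  exact: (@measurable_funPT _ _ _ _ (A v)).
(* [B k] consists of the points with no point of [F] closer than $1/(k+1)$. As [F] is closed, these
   sets cover its complement, so it suffices that [A v] almost surely avoids each of them. *)
pose B k := ~` \bigcup_(s in F) ball s (k.+1%:R^-1 : R).
have mB k : measurable (B k).
  apply: measurableC; apply: open_measurable.
  by apply: bigcup_open => t _; exact: ball_open.
suff PB k : P [set x | B k (A v x)] = 0%E.
  apply: (@negligibleS _ _ _ _ (\bigcup_k [set x | B k (A v x)])); last first.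
    apply: negligible_bigcup => k; apply/negligibleP; last exact: PB.
    by rewrite -[X in _ X]setTI; exact: mAv.
  move=> x /= Fx.
  have : nbhs (A v x) (~` F).
    by apply: open_nbhs_nbhs; split=> //; exact: closed_openC.
  move=> /nbhs_ballP[e/= e0 eF].
  have [k _ /(_ _ (leqnn k))/= ke] := near_infty_natSinv_lt (PosNum e0).
  exists k => // -[w Fw wx]; apply: (eF w) => //.
  by rewrite /ball/= distrC in wx *; apply: lt_trans wx ke.
(* Half of the gap is reserved for the distance from [A_i f] to [A_i g], half for the Lévy-Prokhorov
   displacement. *)
pose s : R := k.+1%:R^-1 / 2.
have s0 : 0 < s by rewrite divr_gt0// invr_gt0.
apply/eqP; rewrite eq_le measure_ge0 andbT.
apply/lee_addgt0Pr => eta eta0; rewrite add0e.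
(* Chosen so that the bound [r.-1 * (K * t)], divided by [s], is at most [eta / 2]; the added 1
   keeps the denominator positive. *)
pose t := s * (eta / 2) / (r.-1%:R * K + 1).
have den0 : 0 < r.-1%:R * K + 1 by rewrite ltr_wpDl// mulr_ge0.
have t0 : 0 < t by rewrite divr_gt0// mulr_gt0// divr_gt0.
have [e0 e00 He] := powR_modulus p1 t0.
(* The three bounds serve the $L^p$ estimate, the displacement and the additive error in
   probability. *)
pose e := Num.min e0 (Num.min s (eta / 2)).
have ep : 0 < e by rewrite !lt_min e00 s0 divr_gt0.
have ee0 : e <= e0 by rewrite /e ge_min lexx.
have es : e <= s by rewrite /e !ge_min lexx !orbT.
have eeta : e <= eta / 2 by rewrite /e !ge_min lexx !orbT.
have [i Ai] : exists i, (dH (profile (A_ i) 1) (profile A 1) < e%:E)%E.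
  have [i _ Hi] := cvA _ (@nbhs_open_ereal_lt _ 0 (fun=> e) ep).
  by exists i; apply: Hi => /=.
have v1 j : {ae P, forall x, -1 <= v j x <= 1}.
  apply: filterS (va j) => x /andP[? ->]; rewrite andbT.
  by apply: le_trans (andP a11).1 _.
have [f f1 fv] := dH_profile_transfer r2 Ai v1.
have fa j : (P_ i [set x | (f j x < a - e)%R] <= e%:E)%E.
  (* Since [v j >= a] almost surely, the event for [v j] is null and only the additive error [e]
     remains. *)
  have [||t1 t2 t1a t12|/(_ j) + _] :=
    fv [set` `]-oo, (a - e)[] [set` `]-oo, a[].
  - exact: measurable_itv.
  - exact: measurable_itv.
  - move: t1a t12; rewrite /= !in_itv/= ltr_norml => ? /andP[? ?]; lra.
  rewrite (_ : [set x | _] = [set x | (f j x < a - e)%R]); last first.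
    by apply/seteqP; split => x /=; rewrite in_itv.
  move=> /le_trans; apply; rewrite -[leRHS]add0e leeD2r//.
  rewrite (_ : [set x | _] = [set x | (v j x < a)%R]); last first.
    by apply/seteqP; split => x /=; rewrite in_itv.
  have mv : measurable [set x | (v j x < a)%R].
    have mv : measurable_fun setT (v j : T -> R).
      exact: (@measurable_funPT _ _ _ _ (v j)).
    by rewrite -[X in _ X]setTI; exact: measurable_fun_ltr.
  rewrite le_eqVlt; apply/orP; left; apply/eqP/(measure_negligible mv).
  by apply: negligibleS (va j) => x /= vx; rewrite leNgt vx.
have [g ga Ag] :=
  truncation_close p1 q1 K0 a11 (ltW ep) (He _ ep ee0) (AK i) f1 fa.
pose B1 := \bigcup_(w in B k) ball w e.
have mB1 : measurable B1.
  by apply: open_measurable; apply: bigcup_open => w _; exact: ball_open.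
have BB1 w1 w2 : B k w2 -> `|w1 - w2| < e -> B1 w1.
  by move=> Bw w12; exists w2 => //; rewrite /ball/= distrC.
have [_ PBe] := fv _ _ (mB k) mB1 BB1.
apply: (le_trans PBe).
rewrite [eta in leRHS]splitr EFinD leeD ?lee_fin//.
pose D := [set x | s <= `|A_ i f x - A_ i g x|].
have mA h : measurable_fun setT (A_ i h : T_ i -> R).
  exact: (@measurable_funPT _ _ _ _ (A_ i h)).
have mD : measurable D.
  rewrite -[D]setTI; apply: measurable_fun_ler => //.
  by apply: measurableT_comp => //; exact: measurable_funB.
have PD : (P_ i D <= (eta / 2)%:E)%E.
  rewrite -(@lee_pmul2l _ s%:E)// -EFinM; apply: le_trans (Ag _ s0) _.
  rewrite lee_fin mulrA /t mulrA ler_pdivrMr// [leLHS]mulrC.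
  rewrite ler_wpM2l ?lerDl//.
  by rewrite mulr_ge0 ?(ltW s0)// divr_ge0// ltW.
have [N [mN N0 FN]] := FA i g ga.
(* Let [A_i f] be within [e] of some [w] in [B k]. Off [N], the value [A_i g] lies in [F]; off [D]
   it would be closer to [w] than [s + s], contradicting the choice of [B k]. *)
apply: (@le_trans _ _ (P_ i (D `|` N))).
  rewrite le_measure ?inE//; [|exact: measurableU|].
    by rewrite -[X in _ X]setTI; exact: mA.
  move=> x [w Bw wx].
  have [Fx|?] := pselect (F (A_ i g x)); last by right; exact: FN.
  left; rewrite /D/= leNgt; apply/negP => Axs; apply: Bw.
  exists (A_ i g x) => //; move: wx; rewrite /ball/= => wx.
  rewrite [k.+1%:R^-1](splitr) -/s.
  rewrite (_ : _ - w = (A_ i f x - w) - (A_ i f x - A_ i g x)); last by ring.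
  apply: (le_lt_trans (ler_normB _ _)); rewrite ltrD// distrC.
  exact: lt_le_trans wx es.
apply: le_trans (measureU2 _ mD mN) _; by rewrite [X in (_ + X)%E]N0 adde0.
Qed.

Lemma Linf_scale_unit {R : realType} {d} {T : measurableType d}
    (P : probability T R) {n : nat} (v : 'I_n -> Linf P) :
  exists2 M : R, 0 < M &
    forall j, {ae P, forall x, `|(M^-1 *: v j : Linf P) x| <= 1}.
Proof.
have /choice[M vM] : forall j, exists M, {ae P, forall x, `|v j x| <= M}.
  move=> j; apply: ess_supr_bounded.
  have := @Lfunction_finite _ _ _ _ _ (@leey R 1%E) (v j).
  by rewrite /finite_norm unlock /= probability_setT lte01.
have S0 : 0 <= \sum_j `|M j| by exact: sumr_ge0.
(* A common bound for all the [v j], positive even when every [M j] is 0. *)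
pose C := 1 + \sum_j `|M j|.
have C0 : 0 < C by rewrite ltr_wpDr.
exists C => // j; apply: filterS (vM j) => x vx.
rewrite [X in `|X|](_ : _ = C^-1 * v j x)// normrM normfV (gtr0_norm C0).
rewrite ler_pdivrMl// mulr1; apply: (le_trans vx).
apply: (le_trans (ler_norm _)); rewrite /C (bigD1 j)//= addrCA lerDl.
by rewrite addr_ge0// sumr_ge0.
Qed.

Theorem lemma7p6 (R : realType) (r : nat) (p : R) (q : \bar R) (c : R)
    (d_ : nat -> measure_display) (T_ : forall i, measurableType (d_ i))
    (P_ : forall i, probability (T_ i) R)
    (A_ : forall i, multiPop (P_ i) r)
    (d : measure_display) (T : measurableType d) (P : probability T R)
    (A : multiPop P r) :
  (2 <= r)%N -> 1 <= p -> (1 <= q)%E ->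
  (ereal_sup [set opnorm p%:E q (A_ i) | i in [set: nat]] < +oo)%E ->
  action_convergent A_ A ->
  ((forall i, positivity_preserving (A_ i)) -> positivity_preserving A) /\
  ((forall i, regular c (A_ i)) -> regular c A).
Proof.
move=> r2 p1 q1 supA cvA; split=> [posA v v0|regA].
- have [M M0 vM] := Linf_scale_unit v.
  have a11 : -1 <= (0 : R) <= 1 by rewrite lerN10 ler01.
  (* Rescaling brings the inputs into $[0,1]$; by [mop_scale] it multiplies the output by a positive
     constant, which preserves its sign. *)
  have : {ae P, forall x, 0 <= A (fun j => M^-1 *: v j) x}.
    apply: (action_limit_closed r2 p1 q1 supA cvA a11 (@closed_ge R 0)).
      by move=> i g g01; apply: posA => j; apply: filterS (g01 j) => x /andP[].
    move=> j; apply: filterS2 (v0 j) (vM j) => x vx0.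
    rewrite ler_norml => /andP[_ ->]; rewrite andbT.
    by rewrite [leRHS](_ : _ = M^-1 * v j x)// mulr_ge0// invr_ge0 ltW.
  apply: filterS2 (mop_scale A v M^-1) => x /(_ I) ->.
  by rewrite pmulr_rge0// exprn_gt0// invr_gt0.
- have a11 : -1 <= (1 : R) <= 1 by apply/andP; split; lra.
  have : {ae P, forall x, A (fun=> Linf_one P) x = c}.
    apply: (action_limit_closed r2 p1 q1 supA cvA a11 (@closed_eq R c)).
      (* Inputs with values in $[1,1]$ equal the constant 1 almost everywhere, so [mop_ae]
         applies. *)
      move=> i g g1; have : (A_ i g : T_ i -> R) = A_ i (fun=> Linf_one (P_ i))
          %[ae P_ i].
        apply: mop_ae => j; apply: filterS (g1 j) => x /andP[? ?] _.
        by apply/eqP; rewrite eq_le; apply/andP.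
      by apply: filterS2 (regA i) => x /(_ I) e1 /(_ I) e2; rewrite /= e2 e1.
    by move=> j; apply: aeW => x /=; rewrite lexx.
  by apply: filterS => x /= + _.
Qed.
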